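(* Let $q_\varepsilon(t)$ be a space change of $q(t)$, $\tau(\varepsilon,t)$ a time change, and $G(\varepsilon,t)$ a BH-function, and suppose $L(t,q(t),\dot q(t))\neq0$ for all $t\in I$. Define the additional BH-function $\mathcal{G}$ and the function $\mathcal{T}$ by $$\mathcal{G}(\varepsilon,t):=\varepsilon\cdot L\bigl(t,q(t),\dot q(t)\bigr)\,\bigl(\partial_\epsilon\tau(\epsilon,t)|_{\epsilon=0}\bigr),\qquad \mathcal{T}(\varepsilon,t):=\varepsilon\cdot\frac{\partial_\epsilon G(\epsilon,t)|_{\epsilon=0}}{L\bigl(t,q(t),\dot q(t)\bigr)} .$$ Then the following three conditions are equivalent: (1) (infinitesimal invariance with space change $q_\varepsilon$ and time change $\tau+\mathcal{T}$) for all $t\in I$, $$\frac{\partial}{\partial\varepsilon}\Bigl(L\bigl(\xi,q_\varepsilon(\xi),\dot q_\varepsilon(\xi)\bigr)\big|_{\xi=\tau(\varepsilon,t)+\mathcal{T}(\varepsilon,t)}\bigl(\partial_t\tau(\varepsilon,t)+\partial_t\mathcal{T}(\varepsilon,t)\bigr)\Bigr)\Big|_{\varepsilon=0}=0 ;$$ (2) (infinitesimal BH-invariance with space change $q_\varepsilon$ and BH-function $G+\mathcal{G}$) for all $t\in I$, $$\frac{\partial}{\partial\varepsilon}\Bigl(L\bigl(t,q_\varepsilon(t),\dot q_\varepsilon(t)\bigr)+\partial_tG(\varepsilon,t)+\partial_t\mathcal{G}(\varepsilon,t)\Bigr)\Big|_{\varepsilon=0}=0 ;$$ (3) (infinitesimal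 BH-invariance with space change $q_\varepsilon$, time change $\tau$ and BH-function $G$) for all $t\in I$, $$\frac{\partial}{\partial\varepsilon}\Bigl(L\bigl(\xi,q_\varepsilon(\xi),\dot q_\varepsilon(\xi)\bigr)\big|_{\xi=\tau(\varepsilon,t)}\,\partial_t\tau(\varepsilon,t)+\partial_tG(\varepsilon,t)\Bigr)\Big|_{\varepsilon=0}=0 .$$
   Context: Let $n\ge1$ and let $L=L(t,q,\dot q)$ (the Lagrangian) be a smooth real-valued function on an open subset of $\mathbb{R}\times\mathbb{R}^n\times\mathbb{R}^n$. A dot over a function denotes the derivative in $t$. Let $t\mapsto q(t)\in\mathbb{R}^n$ be a smooth trajectory (not necessarily a solution to the Lagrange equation) on an open interval $I$ such that $(t,q(t),\dot q(t))$ lies in the domain of $L$ for all $t\in I$. All functions of $(\varepsilon,t)$ below are defined on an open neighbourhood of $\{0\}\times I$ in $\mathbb{R}\times I$ (i.e. for $t\in I$ and $\varepsilon$ close to $0$). A space change of $q$ is a smooth one-parameter family $(\varepsilon,t)\mapsto q_\varepsilon(t)\in\mathbb{R}^n$ with $q_0(t)=q(t)$ for all $t\in I$; $\dot q_\varepsilon(t)$ denotes $\partial_tq_\varepsilon(t)$. A time change is a smooth real function $\tau(\varepsilon,t)$ with $\tau(0,t)=t$ for all $t\in I$. A BH-function is a smooth real function $G(\varepsilon,t)$. *)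

(* Defs.v *)
From mathcomp Require Import all_boot all_order all_algebra.
From mathcomp Require Import all_classical all_reals all_analysis.
Import Order.TTheory GRing.Theory Num.Theory.
Import numFieldNormedType.Exports.

Set Implicit Arguments.
Unset Strict Implicit.
Unset Printing Implicit Defensive.

Local Open Scope classical_set_scope.
Local Open Scope ring_scope.

(* Class C^k on an open set U of a finite-dimensional space V, by Frechet
   derivatives: since V is finite-dimensional, x |-> 'd f x is C^k as an
   operator-valued map iff x |-> 'd f x v is C^k for every vector v.
   Functions are total; only the germs of f at points of U matter. *)
Fixpoint Ck_on (R : realType) (V W : normedModType R) (k : nat)
    (U : set V) (f : V -> W) : Prop :=
  match k with
  | 0%N => forall x, U x -> {for x, continuous f}
  | k'.+1 => (forall x, U x -> differentiable f x) /\
             (forall v : V, Ck_on k' U (fun x => 'd f x v))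
  end.

Definition smooth_on (R : realType) (V W : normedModType R)
    (U : set V) (f : V -> W) : Prop :=
  forall k, Ck_on k U f.

(* An open subset of R x I is an open subset of R x R contained in R x I,
   because I is open in all uses.  The first argument of f is epsilon. *)
Definition smooth_family (R : realType) (W : normedModType R)
    (I : set R) (f : R -> R -> W) : Prop :=
  exists D : set (R * R)%type,
    [/\ open D, D `<=` setT `*` I, [set 0] `*` I `<=` D &
        smooth_on D (fun p : R * R => f p.1 p.2)].

Definition space_change (R : realType) (n : nat) (I : set R)
    (q : R -> 'rV[R]_n) (qe : R -> R -> 'rV[R]_n) : Prop :=
  smooth_family I qe /\ forall t, I t -> qe 0 t = q t.

Definition time_change (R : realType) (I : set R) (tau : R -> R -> R) : Prop :=
  smooth_family I tau /\ forall t, I t -> tau 0 t = t.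

Definition BH_function (R : realType) (I : set R) (G : R -> R -> R) : Prop :=
  smooth_family I G.

Definition jet1 (R : realType) (n : nat) (x : R -> 'rV[R]_n) (xi : R) :
    (R * 'rV[R]_n * 'rV[R]_n)%type :=
  (xi, x xi, derive1 x xi).

(* Main.v *)
Require Import Defs.
From mathcomp Require Import all_boot all_order all_algebra.
From mathcomp Require Import all_classical all_reals all_analysis.
From mathcomp Require Import ring lra.
Import Order.TTheory GRing.Theory Num.Theory.
Import numFieldNormedType.Exports.

(** The three conditions are equivalent for a strong reason: at every time t the
    three epsilon-derivatives are the same number.

    Put F(e, s) := L(s, q_e(s), q_e'(s)) and l(s) := F(0, s) = L(s, q(s), q'(s)),
    and let h and g be the epsilon-derivatives at 0 of tau and G, as functions
    of t.  For any time change sigma with sigma(0, t) = t whose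
    epsilon-derivative at 0 is k, the chain and product rules give
      d/de [F(e, sigma(e, t)) * sigma_t(e, t)] = F_e + l' k + l k'
                                               = F_e + (l k)'
    at e = 0 (lemma is_derive_reparametrized), provided that the mixed partial
    derivatives of sigma agree, so that the epsilon-derivative of sigma_t is k'.
    With k = h + g / l, k = 0 and k = h, the three expressions become
      F_e + (l h + g)',   F_e + g' + (l h)',   F_e + (l h)' + g'.
    Thus tau contributes exactly what the BH-function e * l * h does, and G
    exactly what the time shift e * g / l does.

    Two facts carry the argument.  One is the symmetry of second derivatives
    (second_diff_sym), in Young's form: a function differentiable near a, whose
    derivatives along v and w are differentiable at a, has symmetric second
    derivative there, because both mixed derivatives are the limit of the same
    second difference quotient.  It exchanges d/de and d/dt for tau and G.  The
    other is the differentiability of F at (0, t) (differentiable_jet1), which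
    makes the chain rule available. *)

Local Open Scope classical_set_scope.
Local Open Scope ring_scope.

(** * Differentiation along curves *)

Lemma is_derive_diff_comp {R : realType} {V W : normedModType R}
    (f : V -> W) (c : R -> V) (s : R) (dc : V) :
  is_derive s 1 c dc -> differentiable f (c s) ->
  is_derive s 1 (f \o c) ('d f (c s) dc).
Proof.
move=> [c_drv cE] f_diff.
have c_diff : differentiable c s by apply/derivable1_diffP.
have fc_diff : differentiable (f \o c) s by exact: differentiable_comp.
split; first by apply/derivable1_diffP.
by rewrite deriveE // diff_comp //= -cE deriveE.
Qed.

Lemma is_derive_pair {R : realType} {V W : normedModType R}
    (f : R -> V) (g : R -> W) (s : R) (df : V) (dg : W) :
  is_derive s 1 f df -> is_derive s 1 g dg ->
  is_derive s 1 (fun x => (f x, g x)) (df, dg).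
Proof.
move=> [/derivable1_diffP f_diff fE] [/derivable1_diffP g_diff gE].
have fg_diff : differentiable (fun x => (f x, g x)) s.
  exact: differentiable_pair.
split; first by apply/derivable1_diffP.
by rewrite deriveE // diff_pair // -fE -gE !deriveE.
Qed.

Lemma is_derive_segment {R : realType} {V : normedModType R} (a v : V) (s : R) :
  is_derive s 1 (fun x : R => a + x *: v) v.
Proof.
have H : is_derive s 1 ((cst a : R -> V) + (fun x : R => x *: v)) (0 + 1 *: v).
  apply: is_deriveD.
  have d : differentiable (fun x : R => x *: v) s.
    exact: differentiableZl.
  split; first by apply/derivable1_diffP.
  by rewrite deriveE // diffZl // diff_val.
by rewrite add0r scale1r in H.
Qed.

(** * Symmetry of second derivatives *)

(** The mean value theorem applied to s |-> f(a + s v + k w) - f(a + s v) on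
    [0, k] turns the second difference into k times an increment of
    x |-> 'd f x v, and differentiability of the latter at a evaluates that
    increment up to o(k).  The second difference is symmetric in v and w,
    whereas the hypotheses only involve the derivative along v. *)
Lemma second_difference_near {R : realType} {V : normedModType R}
    (f : V -> R) (a v w : V) :
  (\forall x \near a, differentiable f x) ->
  differentiable (fun x => 'd f x v) a ->
  forall eps : R, 0 < eps -> \forall k \near (0 : R)^'+,
    `|f (a + k *: v + k *: w) - f (a + k *: v) - f (a + k *: w) + f a
      - k ^+ 2 * 'd (fun x => 'd f x v) a w| <= eps * k ^+ 2.
Proof.
move=> f_diff fv_diff eps eps_gt0.
set g := fun x => 'd f x v.
(* The two first-order remainders at s v + k w and s v add up to at most
   (2 |v| + |w|) k times the Taylor tolerance, and the summand 1 makes C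
   positive even when v = w = 0. *)
set C := 2 * `|v| + `|w| + 1.
have C_gt0 : 0 < C by rewrite /C; have := normr_ge0 v; have := normr_ge0 w; lra.
have /eqaddoP/(_ (eps / C)) g_taylor := diff_locally fv_diff.
have {}g_taylor : \forall y \near (0 : V),
    `|g (a + y) - (g a + 'd g a y)| <= eps / C * `|y|.
  have := g_taylor (divr_gt0 eps_gt0 C_gt0).
  by apply: filterS => y; rewrite [a + y]addrC.
have {}f_diff : \forall y \near (0 : V), differentiable f (a + y).
  by move: f_diff; rewrite (near_shift 0 a); apply: filterS => y /=; rewrite subr0 addrC.
have [/= d d_gt0 Hd] := proj1 nbhs_norm0P (filterI g_taylor f_diff).
near=> k.
have k_gt0 : 0 < k by near: k; exact: nbhs_right_gt.
have kC_lt : k * C < d.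
  rewrite -ltr_pdivlMr //; near: k; apply: nbhs_right_lt; exact: divr_gt0.
have small_sv s : s \in `[0, k]%R -> `|s *: v| <= k * `|v|.
  rewrite in_itv/= => /andP[s0 sk]; rewrite normrZ ger0_norm //.
  by rewrite ler_wpM2r.
have small_svkw s : s \in `[0, k]%R -> `|s *: v + k *: w| <= k * (`|v| + `|w|).
  move=> /small_sv sv; apply: (le_trans (ler_normD _ _)).
  by rewrite mulrDr lerD // normrZ gtr0_norm.
have Hsv s : s \in `[0, k]%R -> `|s *: v| < d.
  move=> /small_sv sv; apply: (le_lt_trans sv); apply: le_lt_trans kC_lt.
  rewrite ler_pM2l // /C; have := normr_ge0 v; have := normr_ge0 w; lra.
have Hsvkw s : s \in `[0, k]%R -> `|s *: v + k *: w| < d.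
  move=> /small_svkw sv; apply: (le_lt_trans sv); apply: le_lt_trans kC_lt.
  rewrite ler_pM2l // /C; have := normr_ge0 v; have := normr_ge0 w; lra.
pose phi s := f (a + k *: w + s *: v) - f (a + s *: v).
pose dphi s := g (a + k *: w + s *: v) - g (a + s *: v).
have phi_drv s : s \in `[0, k]%R -> is_derive s 1 phi (dphi s).
  move=> s0k; apply: is_deriveB.
    apply: (is_derive_diff_comp f (fun s => a + k *: w + s *: v)).
      exact: is_derive_segment.
    by rewrite -addrA [_ + s *: v]addrC; have [] := Hd _ (Hsvkw s s0k).
  apply: (is_derive_diff_comp f (fun s => a + s *: v)).
    exact: is_derive_segment.
  by have [] := Hd _ (Hsv s s0k).
have k_ge0 : 0 <= k by exact: ltW.
have phi_cont : {within `[0, k], continuous phi}.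
  apply: derivable_within_continuous => s s0k.
  by have [] := phi_drv s s0k.
have phi_drv_oo s : s \in `]0, k[%R -> is_derive s 1 phi (dphi s).
  move=> s0k; apply: phi_drv.
  exact: (@subset_itv_oo_cc _ _ 0 k s s0k).
have := @MVT_segment R phi dphi 0 k k_ge0 phi_drv_oo.
move=> /(_ phi_cont) [s s0k phiE].
have -> : f (a + k *: v + k *: w) - f (a + k *: v) - f (a + k *: w) + f a
    = phi k - phi 0.
  by rewrite /phi !scale0r !addr0 [a + k *: v + k *: w]addrAC; ring.
have [T1 _] := Hd _ (Hsvkw s s0k); have [T2 _] := Hd _ (Hsv s s0k).
have dgE : 'd g a (s *: v + k *: w) = 'd g a (s *: v) + k * 'd g a w.
  by rewrite linearD [X in _ + X = _]linearZ.
rewrite dgE in T1.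
rewrite phiE subr0.
have -> : dphi s * k - k ^+ 2 * 'd g a w = k * (dphi s - k * 'd g a w) by ring.
rewrite normrM gtr0_norm // [eps * _]mulrC expr2 -mulrA ler_pM2l //.
have -> : dphi s - k * 'd g a w =
   (g (a + (s *: v + k *: w)) - (g a + ('d g a (s *: v) + k * 'd g a w)))
   - (g (a + s *: v) - (g a + 'd g a (s *: v))).
  by rewrite /dphi -(addrA a) [k *: w + _]addrC; ring.
apply: (le_trans (ler_normB _ _)).
apply: (le_trans (lerD T1 T2)).
rewrite -mulrDr mulrAC ler_pdivrMr // [k * eps]mulrC -mulrA ler_pM2l //.
have := small_svkw s s0k; have := small_sv s s0k; rewrite /C; nra.
Unshelve. all: by end_near. Qed.

(** Both second derivatives approximate the same second difference divided by
    k^2, so they cannot differ. *)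
Lemma second_diff_sym {R : realType} {V : normedModType R}
    (f : V -> R) (a v w : V) :
  (\forall x \near a, differentiable f x) ->
  differentiable (fun x => 'd f x v) a ->
  differentiable (fun x => 'd f x w) a ->
  'd (fun x => 'd f x v) a w = 'd (fun x => 'd f x w) a v.
Proof.
move=> f_diff fv_diff fw_diff.
set X := LHS; set Y := RHS; apply/eqP; rewrite -subr_eq0 -normr_le0 leNgt.
apply/negP => XY_gt0.
(* With this tolerance the two approximations place X and Y within
   |X - Y| / 2 of each other. *)
pose eps := `|X - Y| / 4.
have eps_gt0 : 0 < eps by rewrite /eps; lra.
near (0 : R)^'+ => k.
have k_gt0 : 0 < k by near: k; exact: nbhs_right_gt.
have Hv : `|f (a + k *: v + k *: w) - f (a + k *: v) - f (a + k *: w) + f a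
      - k ^+ 2 * X| <= eps * k ^+ 2.
  by near: k; exact: second_difference_near.
have Hw : `|f (a + k *: w + k *: v) - f (a + k *: w) - f (a + k *: v) + f a
      - k ^+ 2 * Y| <= eps * k ^+ 2.
  by near: k; exact: second_difference_near.
rewrite [a + k *: w + k *: v]addrAC in Hw.
have k2_gt0 : 0 < k ^+ 2 by rewrite exprn_gt0.
have := lerD Hw Hv; move/(le_trans (ler_normB _ _)).
rewrite [X in `|X|](_ : _ = k ^+ 2 * (X - Y)); last by ring.
rewrite normrM gtr0_norm // /eps.
nra.
Unshelve. all: by end_near. Qed.

(** * Partial derivatives of smooth families *)

Lemma near_eq_differentiable {R : realType} {V W : normedModType R}
    (f g : V -> W) (x : V) :
  {near x, f =1 g} -> differentiable f x -> differentiable g x.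
Proof.
move=> fg /diff_locallyP[df_cont f_taylor].
have g_taylor : g \o shift x = cst (g x) + 'd f x +o_ 0 id.
  apply/eqaddoP => eps eps_gt0.
  move/eqaddoP/(_ eps eps_gt0) : f_taylor.
  move: (fg); rewrite (near_shift 0 x) => fg0.
  apply: filterS2 fg0 => y /=; rewrite subr0 => fgy.
  rewrite -[X in X -> _]/(is_true (`|f (y + x) - (f x + 'd f x y)| <= eps * `|y|)).
  by rewrite fgy (nbhs_singleton fg).
by apply/diff_locallyP; rewrite (diff_unique df_cont g_taylor).
Qed.

Lemma smooth_on_differentiable {R : realType} {V W : normedModType R}
    (U : set V) (f : V -> W) (x : V) :
  smooth_on U f -> U x -> differentiable f x.
Proof. by move=> /(_ 1%N) [f_diff _]; exact: f_diff. Qed.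

Lemma smooth_on_differentiable_diff {R : realType} {V W : normedModType R}
    (U : set V) (f : V -> W) (v x : V) :
  smooth_on U f -> U x -> differentiable (fun y => 'd f y v) x.
Proof. by move=> /(_ 2%N) [_ /(_ v) [df_diff _]]; exact: df_diff. Qed.

Lemma is_derive_fst {R : realType} {W : normedModType R}
    (F : R * R -> W) (e t : R) :
  differentiable F (e, t) -> is_derive e 1 (fun e => F (e, t)) ('d F (e, t) (1, 0)).
Proof.
move=> F_diff.
apply: (is_derive_diff_comp F (fun e => (e, t))) => //.
exact: is_derive_pair.
Qed.

Lemma is_derive_snd {R : realType} {W : normedModType R}
    (F : R * R -> W) (e t : R) :
  differentiable F (e, t) -> is_derive t 1 (fun t => F (e, t)) ('d F (e, t) (0, 1)).
Proof.
move=> F_diff.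
apply: (is_derive_diff_comp F (fun t => (e, t))) => //.
exact: is_derive_pair.
Qed.

Lemma near_fst {R : realType} (D : set (R * R)) (e t : R) :
  open D -> D (e, t) -> \forall x \near e, D (x, t).
Proof.
move=> D_open Det.
have c : {for e, continuous (fun x : R => (x, t))}.
  by apply/differentiable_continuous/differentiable_pair.
by apply: (c D); exact: open_nbhs_nbhs.
Qed.

Lemma near_snd {R : realType} (D : set (R * R)) (e t : R) :
  open D -> D (e, t) -> \forall x \near t, D (e, x).
Proof.
move=> D_open Det.
have c : {for t, continuous (fun x : R => (e, x))}.
  by apply/differentiable_continuous/differentiable_pair.
by apply: (c D); exact: open_nbhs_nbhs.
Qed.

Lemma derive1_val {R : realType} {W : normedModType R} (f : R -> W) (x : R) (df : W) :
  is_derive x 1 f df -> derive1 f x = df.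
Proof. by move=> [_ <-]; rewrite derive1E. Qed.

Lemma near_eq_derive1 {R : realType} {W : normedModType R} (f g : R -> W) (x : R) :
  {near x, f =1 g} -> derive1 f x = derive1 g x.
Proof. by move=> fg; rewrite !derive1E; exact: near_eq_derive. Qed.

(** The form in which the symmetry of second derivatives is used: f_et is the
    t-derivative of the infinitesimal generator of the family, and it is also
    the epsilon-derivative of the speed. *)
Lemma smooth_family_mixed_partials {R : realType} (I : set R) (f : R -> R -> R) (t : R) :
  smooth_family I f -> I t ->
  exists f_e f_et : R,
    [/\ is_derive (0 : R) (1 : R) (fun e => f e t) f_e,
        is_derive t (1 : R) (fun s => derive1 (fun e => f e s) 0) f_et &
        is_derive (0 : R) (1 : R) (fun e => derive1 (f e) t) f_et].
Proof.
move=> [D [D_open _ ID F_smooth]] It.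
set F := fun p : R * R => f p.1 p.2 in F_smooth.
have D0t : D (0, t) by exact: ID.
have F_diff p : D p -> differentiable F p := smooth_on_differentiable _ _ _ F_smooth.
have dF_diff v p : D p -> differentiable (fun y => 'd F y v) p :=
  smooth_on_differentiable_diff _ _ _ _ F_smooth.
exists ('d F (0, t) (1, 0)), ('d (fun y => 'd F y (1, 0)) (0, t) (0, 1)); split.
- exact: (is_derive_fst F) (F_diff _ D0t).
- apply: near_eq_is_derive (is_derive_snd _ 0 t (dF_diff (1, 0) _ D0t)).
  have := near_snd D 0 t D_open D0t; apply: filterS => s D0s /=.
  by rewrite (derive1_val _ _ _ (is_derive_fst F 0 s (F_diff _ D0s))).
- rewrite second_diff_sym; last 2 first.
  + exact: dF_diff.
  + exact: dF_diff.
  + apply: near_eq_is_derive (is_derive_fst _ 0 t (dF_diff (0, 1) _ D0t)).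
    have := near_fst D 0 t D_open D0t; apply: filterS => e Det /=.
    by rewrite (derive1_val _ _ _ (is_derive_snd F e t (F_diff _ Det))).
  + have : nbhs (0 : R, t) D by exact: open_nbhs_nbhs.
    apply: filterS => p; exact: F_diff.
Qed.

(** The velocity component of the jet is the partial derivative in t, which
    near (0, t) is the differential of the family in the direction (0, 1). *)
Lemma differentiable_jet1 {R : realType} {n : nat} (I : set R)
    (qe : R -> R -> 'rV[R]_n) (t : R) :
  smooth_family I qe -> I t ->
  differentiable (fun p : R * R => jet1 (qe p.1) p.2) (0, t).
Proof.
move=> [D [D_open _ ID Q_smooth]] It.
set Q := fun p : R * R => qe p.1 p.2 in Q_smooth.
have D0t : D (0, t) by exact: ID.
have Q_diff p : D p -> differentiable Q p := smooth_on_differentiable _ _ _ Q_smooth.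
have dQ_diff : differentiable (fun p => 'd Q p (0, 1)) (0, t).
  exact: smooth_on_differentiable_diff Q_smooth D0t.
have snd_diff : differentiable (snd : R * R -> R) (0, t).
  apply: (@linear_differentiable _ _ _ snd) => p; exact: cvg_snd.
apply: (@near_eq_differentiable _ _ _ (fun p => (p.2, Q p, 'd Q p (0, 1)))).
  have : nbhs (0 : R, t) D by exact: open_nbhs_nbhs.
    apply: filterS => -[e s] Des.
  by rewrite /jet1 (derive1_val _ _ _ (is_derive_snd Q e s (Q_diff _ Des))).
apply: differentiable_pair dQ_diff.
by apply: differentiable_pair => //; exact: Q_diff.
Qed.

(** * The variation of the action density *)

(** First variation of F(e, sigma(e)) * w(e), where sigma is the epsilon-curve
    of a time change through t and w is its speed.  Keeping sigma and w as
    independent functions covers both tau and tau + T, without a smoothness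
    proof for the latter. *)
Lemma is_derive_reparametrized {R : realType} (F : R * R -> R) (t : R)
    (sigma w : R -> R) (dsigma dw : R) :
  differentiable F (0, t) -> sigma 0 = t -> w 0 = 1 ->
  is_derive (0 : R) (1 : R) sigma dsigma -> is_derive (0 : R) (1 : R) w dw ->
  is_derive (0 : R) (1 : R) (fun e => F (e, sigma e) * w e)
    ('d F (0, t) (1, 0) + 'd F (0, t) (0, 1) * dsigma + F (0, t) * dw).
Proof.
move=> F_diff sigma0 w0 sigma_drv w_drv.
rewrite -sigma0 in F_diff *.
have Fs_drv : is_derive (0 : R) (1 : R) (fun e => F (e, sigma e)) ('d F (0, sigma 0) (1, dsigma)).
  apply: (is_derive_diff_comp F (fun e => (e, sigma e))) => //.
  exact: is_derive_pair.
have -> : 'd F (0, sigma 0) (1, 0) + 'd F (0, sigma 0) (0, 1) * dsigma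
    = 'd F (0, sigma 0) (1, dsigma).
  have -> : (1, dsigma) = (1, 0) + dsigma *: (0, 1) :> R * R.
    by congr (_, _) => /=; rewrite ?scaler0 ?addr0 ?add0r // [RHS]mulr1.
  by rewrite linearD [X in _ = _ + X]linearZ mulrC.
apply: (is_derive_eq (is_deriveM Fs_drv w_drv)).
by rewrite w0 scale1r addrC.
Qed.

(** For a family linear in epsilon, such as the two auxiliary families built
    from the generators of tau and G, the mixed derivative needs no second-order
    regularity. *)
Lemma is_derive_linear_family {R : realType} (k : R -> R) (t dk : R) :
  is_derive t 1 k dk ->
  is_derive (0 : R) (1 : R) (fun e => derive1 (fun s => e * k s) t) dk.
Proof.
move=> k_drv.
have -> : (fun e => derive1 (fun s => e * k s) t) = (fun e => 0 + e *: dk).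
  apply/funext => e; rewrite add0r; exact: derive1_val.
exact: is_derive_segment.
Qed.

Lemma time_change_derive1_at0 {R : realType} (I : set R) (tau : R -> R -> R) (t : R) :
  open I -> time_change I tau -> I t -> derive1 (tau 0) t = 1.
Proof.
move=> I_open [_ tau0] It; rewrite (near_eq_derive1 _ id) ?derive1_id //.
have : nbhs t I by exact: open_nbhs_nbhs.
by apply: filterS => s; exact: tau0.
Qed.

Lemma space_change_jet1_at0 {R : realType} {n : nat} (I : set R)
    (q : R -> 'rV[R]_n) (qe : R -> R -> 'rV[R]_n) (t : R) :
  open I -> space_change I q qe -> I t -> jet1 (qe 0) t = jet1 q t.
Proof.
move=> I_open [_ qe0] It; rewrite /jet1 qe0 // (near_eq_derive1 _ q) //.
have : nbhs t I by exact: open_nbhs_nbhs.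
by apply: filterS => s; exact: qe0.
Qed.

Theorem theorem7 (R : realType) (n : nat) (n_ge1 : (1 <= n)%N)
    (Omega : set (R * 'rV[R]_n * 'rV[R]_n)%type)
    (L : R * 'rV[R]_n * 'rV[R]_n -> R)
    (Omega_open : open Omega) (L_smooth : smooth_on Omega L)
    (I : set R) (I_open : open I) (I_itv : is_interval I)
    (q : R -> 'rV[R]_n) (q_smooth : smooth_on I q)
    (q_dom : forall t, I t -> Omega (jet1 q t))
    (qe : R -> R -> 'rV[R]_n) (qe_space : space_change I q qe)
    (tau : R -> R -> R) (tau_time : time_change I tau)
    (G : R -> R -> R) (G_BH : BH_function I G)
    (L_neq0 : forall t, I t -> L (jet1 q t) != 0) :
  let calG : R -> R -> R :=
    fun e t => e * L (jet1 q t) * derive1 (fun s => tau s t) 0 in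
  let calT : R -> R -> R :=
    fun e t => e * (derive1 (fun s => G s t) 0 / L (jet1 q t)) in
  let invariance1 := forall t, I t ->
    derive1 (fun e => L (jet1 (qe e) (tau e t + calT e t))
                      * (derive1 (tau e) t + derive1 (calT e) t)) 0 = 0 in
  let invariance2 := forall t, I t ->
    derive1 (fun e => L (jet1 (qe e) t) + derive1 (G e) t
                      + derive1 (calG e) t) 0 = 0 in
  let invariance3 := forall t, I t ->
    derive1 (fun e => L (jet1 (qe e) (tau e t)) * derive1 (tau e) t
                      + derive1 (G e) t) 0 = 0 in
  (invariance1 <-> invariance2) /\ (invariance2 <-> invariance3).
Proof.
move=> calG calT invariance1 invariance2 invariance3.
suff variation t : I t -> exists variation : R,
    [/\ derive1 (fun e => L (jet1 (qe e) (tau e t + calT e t))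
                      * (derive1 (tau e) t + derive1 (calT e) t)) 0 = variation,
        derive1 (fun e => L (jet1 (qe e) t) + derive1 (G e) t
                      + derive1 (calG e) t) 0 = variation &
        derive1 (fun e => L (jet1 (qe e) (tau e t)) * derive1 (tau e) t
                      + derive1 (G e) t) 0 = variation].
  rewrite /invariance1 /invariance2 /invariance3.
  split; split=> inv t It; have [x [v1 v2 v3]] := variation t It;
    by have := inv t It; rewrite ?v1 ?v2 ?v3.
move=> It.
have It_near : \forall s \near t, I s by exact: open_nbhs_nbhs.
(* F is the Lagrangian along the varied trajectory, l its value at epsilon 0. *)
pose l s := L (jet1 q s).
pose F p := L (jet1 (qe p.1) p.2).
have F0 s : I s -> F (0, s) = l s.
  by move=> Is; rewrite /F /l (space_change_jet1_at0 I q).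
have F_diff : differentiable F (0, t).
  apply: (@differentiable_comp _ _ _ _ (fun p : R * R => jet1 (qe p.1) p.2) L).
    exact: differentiable_jet1 (proj1 qe_space) It.
  rewrite /= (space_change_jet1_at0 I q) //.
  exact: smooth_on_differentiable L_smooth (q_dom t It).
set F_e := 'd F (0, t) (1, 0); set F_t := 'd F (0, t) (0, 1).
have l_drv : is_derive t 1 l F_t.
  by apply: near_eq_is_derive (is_derive_snd F 0 t F_diff); apply: filterS It_near.
have [h [dh [tau_e h_drv tau_te]]] :=
  smooth_family_mixed_partials I tau t (proj1 tau_time) It.
have [g [dg [G_e g_drv G_te]]] := smooth_family_mixed_partials I G t G_BH It.
have hE := derive1_val _ _ _ tau_e; have gE := derive1_val _ _ _ G_e.
have tau0 : tau 0 t = t by exact: (proj2 tau_time).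
have dtau0 : derive1 (tau 0) t = 1 by exact: (time_change_derive1_at0 I).
have l_neq0 : l t != 0 by exact: L_neq0.
have calG_te : is_derive (0 : R) (1 : R) (fun e => derive1 (calG e) t)
    (F_t * h + l t * dh).
  have lh_drv := is_deriveM l_drv h_drv.
  rewrite hE in lh_drv.
  rewrite (_ : (fun e => _) =
      fun e => derive1 (fun s => e * (l s * derive1 (fun e => tau e s) 0)) t).
    apply: is_derive_linear_family.
    apply: (is_derive_eq lh_drv).
    by rewrite addrC [h *: _]mulrC.
  by apply/funext => e; congr (derive1 _ t); apply/funext => s; rewrite mulrA.
(* The quotient rule for g / l. *)
set dT := dg / l t - g * F_t / l t ^+ 2.
have calT_drv : is_derive t 1 (fun s => derive1 (fun e => G e s) 0 / l s) dT.
  have lV_drv : is_derive t 1 (fun s => (l s)^-1) (- (l t) ^- 2 *: F_t).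
    have [l_dv lE] := l_drv.
    by split; [exact: derivableV | rewrite deriveV // lE].
  apply: (is_derive_eq (is_deriveM g_drv lV_drv)).
  by rewrite gE /dT /GRing.scale /=; ring.
have calT_te := is_derive_linear_family _ _ _ calT_drv.
(* This is F_e + (l h + g)'. *)
exists (F_e + F_t * h + l t * dh + dg); split.
- have sigma_e : is_derive (0 : R) (1 : R) (fun e => tau e t + calT e t) (h + g / l t).
    apply: is_deriveD.
    have := is_derive_segment (0 : R) (derive1 (fun s => G s t) 0 / l t) 0.
    rewrite gE; set c := fun _ => _.
    by rewrite (_ : c = calT^~ t) //; apply/funext => e; rewrite /c add0r /calT gE.
  have w_e := is_deriveD tau_te calT_te.
  have sigma0 : tau 0 t + calT 0 t = t by rewrite /calT mul0r addr0.
  have w0 : derive1 (tau 0) t + derive1 (calT 0) t = 1.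
    rewrite dtau0 (_ : calT 0 = cst 0) ?derive1_cst ?addr0 //.
    by apply/funext => s; rewrite /calT mul0r.
  have := is_derive_reparametrized F t _ _ _ _ F_diff sigma0 w0 sigma_e w_e.
  move=> /derive1_val ->; rewrite F0 // /dT -/F_e -/F_t.
  by field.
- have L_e := is_derive_fst F 0 t F_diff.
  have := is_deriveD (is_deriveD L_e G_te) calG_te.
  by move=> /derive1_val ->; rewrite -/F_e; ring.
- have L_e := is_derive_reparametrized F t _ _ _ _ F_diff tau0 dtau0 tau_e tau_te.
  have := is_deriveD L_e G_te.
  by move=> /derive1_val ->; rewrite F0.
Qed.
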